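(* The map $\Gamma\mapsto\mathrm{h}(\Gamma)$ is upper semicontinuous on $\mathfrak{G}$. In particular, if $G$ is a compactly generated totally disconnected locally compact group such that the closure $\overline{\mathfrak{G}(G)}$ of $\mathfrak{G}(G)$ in $\mathfrak{G}$ contains an amenable graph, then $\mathrm{h}_G=0$.
   Context: For a set $A$ of vertices of a graph $\Gamma$, $\partial A$ is the set of vertices not in $A$ that have a neighbour in $A$. The Cheeger constant is $\mathrm{h}(\Gamma)=\inf |\partial A|/|A|$ over finite non-empty sets $A$ of vertices, and $\Gamma$ is amenable if $\mathrm{h}(\Gamma)=0$. $\mathfrak{G}$ is the set of isomorphism classes of connected, locally finite, vertex-transitive graphs, with the topology given by the following distance: two graphs $\Gamma,\Gamma'\in\mathfrak{G}$ are at distance at most $2^{-n}$ if their balls of radius $n$ (induced subgraphs on the vertices at distance at most $n$ from a given vertex, rooted at that vertex) are isomorphic. All actions of topological groups on graphs are by graph automorphisms and continuous, i.e. the induced homomorphism $G\to\mathrm{Aut}(\Gamma)$ is continuous for the topology of pointwise convergence on $\mathrm{Aut}(\Gamma)$. An action is proper if vertex stabilisers are compact in $G$, and transitive if there is a unique orbit of vertices. $\mathfrak{G}(G)\subseteq\mathfrak{G}$ is the subset of graphs admitting a proper transitive action of $G$, and $\mathrm{h}_G=\inf_{\Gamma\in\mathfrak{G}(G)}\mathrm{h}(\Gamma)$. *)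

(* Defs.v *)
From HB Require Import structures.
From mathcomp Require Import all_boot all_order all_algebra.
From mathcomp Require Import generic_quotient finmap.
From mathcomp Require Import all_classical all_reals all_analysis.

Set Implicit Arguments.
Unset Strict Implicit.
Unset Printing Implicit Defensive.

Import Order.TTheory GRing.Theory Num.Theory.

Local Open Scope classical_set_scope.
Local Open Scope quotient_scope.

Record graph := Graph {
  vertex :> Type;
  adj : rel vertex;
  adj_sym : symmetric adj;
  adj_irr : irreflexive adj }.

Definition is_graph_iso (X Y : graph) (f : X -> Y) : Prop :=
  bijective f /\ forall u v, adj (f u) (f v) = adj u v.

Record graph_aut (X : graph) := GraphAut {
  aut_fun :> X -> X;
  aut_fun_iso : is_graph_iso aut_fun }.

Definition graph_ball (X : graph) (n : nat) (o : X) : set X :=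
  [set v | exists p : seq X, [/\ path (@adj X) o p, last o p = v & (size p <= n)%N]].

Definition graph_connected (X : graph) : Prop :=
  inhabited X /\
  forall u v : X, exists p : seq X, path (@adj X) u p /\ last u p = v.

Definition locally_finite (X : graph) : Prop :=
  forall v : X, finite_set [set u | adj v u].

Definition vertex_transitive (X : graph) : Prop :=
  forall u v : X, exists a : graph_aut X, a u = v.

Record vtgraph := VTGraph {
  vt_graph :> graph;
  vt_connected : graph_connected vt_graph;
  vt_locally_finite : locally_finite vt_graph;
  vt_transitive : vertex_transitive vt_graph }.

HB.instance Definition _ := gen_eqMixin vtgraph.
HB.instance Definition _ := gen_choiceMixin vtgraph.

(* Isomorphism of the rooted graphs induced on two balls; the values of f
   outside the ball play no role. *)
Definition is_ball_iso (X Y : graph) (n : nat) (o : X) (o' : Y) (f : X -> Y) :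
    Prop :=
  [/\ set_bij (graph_ball n o) (graph_ball n o') f, f o = o'
    & forall u v, graph_ball n o u -> graph_ball n o v ->
        adj (f u) (f v) = adj u v].

Definition balls_iso (n : nat) (X Y : graph) : Prop :=
  exists (o : X) (o' : Y) (f : X -> Y), is_ball_iso n o o' f.

Section BallIso.
Implicit Types X Y Z : graph.

Lemma graph_ball0 X (o v : X) : graph_ball 0 o v <-> v = o.
Proof.
split=> [[[|x p] [//= _ <-]]//|->].
by exists [::].
Qed.

Lemma graph_ballS X n (o v : X) : graph_ball n.+1 o v <->
  graph_ball n o v \/ exists2 u, graph_ball n o u & adj u v.
Proof.
split.
- case=> p; case/lastP: p => [|p x] [].
    by move=> _ /= <- _; left; exists [::].
  rewrite rcons_path last_rcons size_rcons => /andP[pp ax] <- sp.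
  by right; exists (last o p) => //; exists p.
- case=> [[p [pp lp sp]]|[u [p [pp lp sp]] uv]].
    by exists p; split=> //; exact: leqW.
  exists (rcons p v); rewrite rcons_path last_rcons size_rcons; split=> //.
  by rewrite pp lp uv.
Qed.

Lemma graph_ball_le X m n (o v : X) :
  (m <= n)%N -> graph_ball m o v -> graph_ball n o v.
Proof. by move=> mn [p [pp lp sp]]; exists p; split=> //; exact: leq_trans mn. Qed.

Lemma graph_ball_center X n (o : X) : graph_ball n o o.
Proof. by exists [::]. Qed.

Lemma is_ball_isoE X Y n (o : X) (o' : Y) f : is_ball_iso n o o' f <->
  [/\ forall v, graph_ball n o v -> graph_ball n o' (f v),
      forall u v, graph_ball n o u -> graph_ball n o v -> f u = f v -> u = v,
      forall w, graph_ball n o' w -> exists2 v, graph_ball n o v & f v = w,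
      f o = o'
    & forall u v, graph_ball n o u -> graph_ball n o v ->
        adj (f u) (f v) = adj u v].
Proof.
split.
- case=> -[ff fi fs] foo fa; split=> // u v bu bv.
  by apply: fi; rewrite inE.
- case=> ff fi fs foo fa; split=> //; split=> // u v.
  by rewrite !inE => bu bv; exact: fi.
Qed.

Lemma is_ball_iso_le X Y m n (o : X) (o' : Y) f :
  (m <= n)%N -> is_ball_iso n o o' f -> is_ball_iso m o o' f.
Proof.
move=> mn /is_ball_isoE[ff fi fs foo fa].
have to k v : (k <= n)%N -> graph_ball k o v -> graph_ball k o' (f v).
  elim: k v => [|k IH] v kn; first by move/graph_ball0 => ->; apply/graph_ball0.
  move=> bv; apply/graph_ballS; have /graph_ballS[bv'|[u bu uv]] := bv.
    by left; apply: IH bv'; exact: ltnW.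
  right; exists (f u); first by apply: IH bu; exact: ltnW.
  by rewrite fa//; [apply: graph_ball_le bu; exact: ltnW|exact: graph_ball_le bv].
have from k w : (k <= n)%N -> graph_ball k o' w ->
    exists2 v, graph_ball k o v & f v = w.
  elim: k w => [|k IH] w kn.
    by move/graph_ball0 => ->; exists o => //; exact/graph_ball0.
  move=> bw; have /graph_ballS[bw'|[u' bu' uw]] := bw.
    have [v bv <-] := IH w (ltnW kn) bw'.
    by exists v => //; apply: graph_ball_le bv.
  have [u bu fu] := IH u' (ltnW kn) bu'.
  have [v bv fv] := fs w (graph_ball_le kn bw).
  exists v => //; apply/graph_ballS; right; exists u => //.
  by rewrite -fa ?fu ?fv//; apply: graph_ball_le bu; exact: ltnW.
apply/is_ball_isoE; split=> //.
- by move=> v; exact: to.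
- by move=> u v bu bv; apply: fi; [exact: graph_ball_le bu|exact: graph_ball_le bv].
- by move=> w; exact: from.
- by move=> u v bu bv; apply: fa; [exact: graph_ball_le bu|exact: graph_ball_le bv].
Qed.

Lemma is_ball_iso_sym X Y n (o : X) (o' : Y) f :
  is_ball_iso n o o' f -> exists g, is_ball_iso n o' o g.
Proof.
move=> /is_ball_isoE[ff fi fs foo fa].
have /choice[g gP] w : exists v, graph_ball n o' w -> graph_ball n o v /\ f v = w.
  case: (pselect (graph_ball n o' w)) => [/fs[v bv fv]|nw]; first by exists v.
  by exists o => /nw.
exists g; apply/is_ball_isoE; split.
- by move=> w /gP[].
- by move=> u v /gP[_ {2}<-] /gP[_ {2}<-] ->.
- move=> v bv; exists (f v); first exact: ff.
  by have [bg] := gP _ (ff _ bv); exact: fi.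
- have [bg] := gP _ (graph_ball_center n o').
  by rewrite -[X in _ = X]foo; apply: fi => //; exact: graph_ball_center.
- by move=> u v /gP[bu fu] /gP[bv fv]; rewrite -(fa _ _ bu bv) fu fv.
Qed.

Lemma is_ball_iso_comp X Y Z n (o : X) (o' : Y) (o'' : Z) f g :
  is_ball_iso n o o' f -> is_ball_iso n o' o'' g ->
  is_ball_iso n o o'' (g \o f).
Proof.
move=> /is_ball_isoE[ff fi fs foo fa] /is_ball_isoE[gf gi gs goo ga].
apply/is_ball_isoE; split=> /=.
- by move=> v /ff/gf.
- by move=> u v bu bv /(gi _ _ (ff _ bu) (ff _ bv)); exact: fi.
- by move=> w /gs[v' /fs[v bv <-] <-]; exists v.
- by rewrite foo.
- by move=> u v bu bv; rewrite ga ?fa//; exact: ff.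
Qed.

Lemma graph_iso_ball X Y n (o : X) (f : X -> Y) :
  is_graph_iso f -> is_ball_iso n o (f o) f.
Proof.
move=> [[g fK gK] fa].
have to (X' Y' : graph) (h : X' -> Y') k (c v : X') :
    (forall u v, adj (h u) (h v) = adj u v) ->
    graph_ball k c v -> graph_ball k (h c) (h v).
  move=> ha [p [pp lp sp]]; exists (map h p).
  split; last by rewrite size_map.
    by rewrite path_map (eq_path (e' := @adj X')).
  by rewrite last_map lp.
apply/is_ball_isoE; split=> //.
- by move=> v; exact: to.
- by move=> u v _ _; exact: (can_inj fK).
- move=> w bw; exists (g w) => //; rewrite -(fK o).
  by apply: to bw => u v; rewrite -fa !gK.
Qed.

Lemma is_graph_iso_id X : is_graph_iso (@id X).
Proof. by split=> //; exists id. Qed.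

Lemma is_graph_iso_comp X Y Z (f : X -> Y) (g : Y -> Z) :
  is_graph_iso f -> is_graph_iso g -> is_graph_iso (g \o f).
Proof.
move=> [fb fa] [gb ga]; split; first exact: bij_comp.
by move=> u v /=; rewrite ga fa.
Qed.

Lemma is_graph_iso_inv X Y (f : X -> Y) (g : Y -> X) :
  is_graph_iso f -> cancel f g -> cancel g f -> is_graph_iso g.
Proof.
by move=> [_ fa] fK gK; split; [exists f|move=> u v; rewrite -fa !gK].
Qed.

End BallIso.

Definition vtgraph_isob (X Y : vtgraph) : bool :=
  `[< exists f : X -> Y, is_graph_iso f >].

Lemma vtgraph_iso_refl : reflexive vtgraph_isob.
Proof. by move=> X; apply/asboolP; exists id; exact: is_graph_iso_id. Qed.

Lemma vtgraph_iso_sym : symmetric vtgraph_isob.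
Proof.
suff H X Y : vtgraph_isob X Y -> vtgraph_isob Y X.
  by move=> X Y; apply/idP/idP; exact: H.
move=> /asboolP[f fiso]; apply/asboolP.
by have [[g fK gK] _] := fiso; exists g; exact: (is_graph_iso_inv fiso).
Qed.

Lemma vtgraph_iso_trans : transitive vtgraph_isob.
Proof.
move=> Y X Z /asboolP[f fi] /asboolP[g gi]; apply/asboolP.
by exists (g \o f); exact: is_graph_iso_comp.
Qed.

Canonical vtgraph_iso :=
  EquivRel vtgraph_isob vtgraph_iso_refl vtgraph_iso_sym vtgraph_iso_trans.

(* The set of isomorphism classes. The parameter R is only there so that
   the space can carry a distance with values in R; the class of X : vtgraph is
   \pi_(vtspace R) X. *)
Definition vtspace (R : realType) : Type := {eq_quot vtgraph_iso}.

HB.instance Definition _ (R : realType) := Choice.on (vtspace R).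
HB.instance Definition _ (R : realType) :=
  EqQuotient.copy (vtspace R) {eq_quot vtgraph_iso}.

Section VTMetric.
Variable R : realType.
Local Open Scope ring_scope.
Implicit Types X Y Z : vtgraph.

Definition ball_dist (X Y : graph) : R :=
  inf [set 2 ^- n | n in [set n | balls_iso n X Y]].

Lemma balls_iso_any n X Y : balls_iso n X Y ->
  forall (o : X) (o' : Y), exists f, is_ball_iso n o o' f.
Proof.
move=> [ o1 [ o1' [f fiso]]] o o'.
have [a ao] := vt_transitive o o1.
have [b bo] := vt_transitive o1' o'.
exists (b \o (f \o a)); apply: (@is_ball_iso_comp _ _ _ _ _ o1').
  apply: (@is_ball_iso_comp _ _ _ _ _ o1) fiso.
  by rewrite -ao; apply: graph_iso_ball; exact: aut_fun_iso.
by rewrite -bo; apply: graph_iso_ball; exact: aut_fun_iso.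
Qed.

Lemma balls_iso_le m n X Y : (m <= n)%N -> balls_iso n X Y -> balls_iso m X Y.
Proof.
by move=> mn [ o [ o' [f fi]]]; exists o, o', f; exact: is_ball_iso_le fi.
Qed.

Lemma balls_iso_sym n X Y : balls_iso n X Y -> balls_iso n Y X.
Proof.
by move=> [ o [ o' [f /is_ball_iso_sym[g gi]]]]; exists o', o, g.
Qed.

Lemma balls_iso_trans n X Y Z :
  balls_iso n X Y -> balls_iso n Y Z -> balls_iso n X Z.
Proof.
move=> [ o [ o' [f fi]]] /[dup] -[_ [ o'' _]] /balls_iso_any/(_ o' o'')[g gi].
by exists o, o'', (g \o f); exact: is_ball_iso_comp gi.
Qed.

Lemma balls_iso0 X Y : balls_iso 0 X Y.
Proof.
have [[ o] _] := vt_connected X; have [[ o'] _] := vt_connected Y.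
exists o, o', (fun=> o'); apply/is_ball_isoE; split=> //.
- by move=> v _; exact/graph_ball0.
- by move=> u v /graph_ball0 -> /graph_ball0 ->.
- by move=> w /graph_ball0 ->; exists o => //; exact/graph_ball0.
- by move=> u v /graph_ball0 -> /graph_ball0 ->; rewrite !adj_irr.
Qed.

Lemma balls_iso_of_iso n X Y : vtgraph_isob X Y -> balls_iso n X Y.
Proof.
move=> /asboolP[f fi]; have [[ o] _] := vt_connected X.
by exists o, (f o), f; exact: graph_iso_ball.
Qed.

Lemma ball_dist_le n X Y : balls_iso n X Y -> ball_dist X Y <= 2 ^- n.
Proof.
move=> nXY; apply: ge_inf; last by exists n.
by exists 0 => _ [m _ <-]; rewrite invr_ge0 exprn_ge0.
Qed.

Lemma ball_dist_lt X Y (e : R) :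
  ball_dist X Y < e -> exists2 n, balls_iso n X Y & 2 ^- n < e.
Proof.
move=> /inf_lt[|_ [n nXY <-] ne]; last by exists n.
by exists (2 ^- 0), 0%N => //; exact: balls_iso0.
Qed.

Lemma ball_dist_ge0 X Y : 0 <= ball_dist X Y.
Proof.
apply: lb_le_inf; first by exists (2 ^- 0), 0%N => //; exact: balls_iso0.
by move=> _ [m _ <-]; rewrite invr_ge0 exprn_ge0.
Qed.

Lemma ball_dist_sym X Y : ball_dist X Y = ball_dist Y X.
Proof.
rewrite /ball_dist; congr inf; apply/seteqP.
by split=> _ [n nXY <-]; exists n => //; exact: balls_iso_sym.
Qed.

Lemma ball_dist_ultra Y X Z :
  ball_dist X Z <= Num.max (ball_dist X Y) (ball_dist Y Z).
Proof.
rewrite leNgt; apply/negP; rewrite gt_max => /andP[].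
move=> /ball_dist_lt[n nXY nd] /ball_dist_lt[m mYZ md].
have := ball_dist_le (balls_iso_trans (balls_iso_le (geq_minl n m) nXY)
  (balls_iso_le (geq_minr n m) mYZ)).
by rewrite leNgt /minn; case: ifP => _; rewrite ?nd ?md.
Qed.

Lemma ball_dist_iso X Y Z : vtgraph_isob X Y -> ball_dist X Z = ball_dist Y Z.
Proof.
move=> XY; rewrite /ball_dist; congr inf; apply/seteqP.
split=> _ [n niso <-]; exists n => //.
  by apply: balls_iso_trans niso; apply: balls_iso_sym; exact: balls_iso_of_iso.
by apply: balls_iso_trans niso; exact: balls_iso_of_iso.
Qed.

Lemma graph_ball_finite X n (o : X) : finite_set (graph_ball n o).
Proof.
elim: n => [|n IH].
  by rewrite (_ : graph_ball 0 o = [set o])//; apply/seteqP; split=> v /=;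
    move/graph_ball0.
rewrite (_ : graph_ball n.+1 o = graph_ball n o `|`
    \bigcup_(u in graph_ball n o) [set v | adj u v]); last first.
  by apply/seteqP; split=> v /=; move/graph_ballS.
rewrite finite_setU; split=> //; apply: bigcup_finite => // u _.
exact: vt_locally_finite.
Qed.

Lemma ultra_finite_pigeon (T U : Type) (F : set_system T) (A : set U)
    (P : U -> set T) :
  UltraFilter F -> finite_set A -> F (\bigcup_(a in A) P a) ->
  exists2 a, A a & F (P a).
Proof.
move=> FU /(@finite_fsetP {classic U})[D AD] FAP; apply: contrapT => nA.
have FC : F (\bigcap_(a in [set` D]) ~` P a).
  apply: filter_bigI => a aD; have [FPa|//] := in_ultra_setVsetC (P a) FU.
  by exfalso; apply: nA; exists a => //; rewrite AD.
have [t [[a Aa Pa] nPa]] := filter_ex (filterI FAP FC).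
by apply: (nPa a) => //; rewrite AD in Aa.
Qed.

Lemma graph_ball_reach X (o v : X) : exists n, graph_ball n o v.
Proof.
have [_ /(_ o v)[p [pp lp]]] := vt_connected X.
by exists (size p), p.
Qed.

Lemma balls_iso_iso X Y : (forall n, balls_iso n X Y) -> vtgraph_isob X Y.
Proof.
move=> XY; apply/asboolP.
have [[ o] _] := vt_connected X; have [[ o'] _] := vt_connected Y.
have /choice[f fP] n := balls_iso_any (XY n) o o'.
have [F [FU oF]] := ultraFilterLemma eventually_filter.
have Fge n : F [set m | (n <= m)%N] by apply: oF; exact: nbhs_infty_ge.
have fn n v d : graph_ball d o v -> (d <= n)%N -> graph_ball d o' (f n v).
  by move=> bv dn; have /is_ball_isoE[H _ _ _ _] := is_ball_iso_le dn (fP n);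
    exact: H.
have /choice[g gP] v : exists w, F [set n | f n v = w].
  have [d bv] := graph_ball_reach o v.
  have [|w _ Fw] := @ultra_finite_pigeon nat Y F (graph_ball d o')
      (fun w => [set n | f n v = w]) FU (graph_ball_finite d o').
    by apply: filterS (Fge d) => n dn; exists (f n v) => //; exact: fn.
  by exists w.
have g2 u v : exists n, [/\ f n u = g u, f n v = g v,
    graph_ball n o u & graph_ball n o v].
  have [d bu] := graph_ball_reach o u; have [e bv] := graph_ball_reach o v.
  have [n [[[fu fv] dn] en]] :=
    filter_ex (filterI (filterI (filterI (gP u) (gP v)) (Fge d)) (Fge e)).
  by exists n; split=> //; [exact: graph_ball_le bu|exact: graph_ball_le bv].
have ginj : injective g.
  move=> u v; have [n [<- <- bu bv]] := g2 u v.
  by have /is_ball_isoE[_ H _ _ _] := fP n; exact: H.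
have gsurj w : exists v, g v = w.
  have [d bw] := graph_ball_reach o' w.
  have [|v _ Fv] := @ultra_finite_pigeon nat X F (graph_ball d o)
      (fun v => [set n | f n v = w]) FU (graph_ball_finite d o).
    apply: filterS (Fge d) => n dn.
    have /is_ball_isoE[_ _ H _ _] := is_ball_iso_le dn (fP n).
    by have [v bv fv] := H _ bw; exists v.
  by exists v; have [n [/= <- <-]] := filter_ex (filterI (gP v) Fv).
have [h hK] := choice gsurj.
exists g; split; first by exists h => // v; apply: ginj; rewrite hK.
move=> u v; have [n [<- <- bu bv]] := g2 u v.
by have /is_ball_isoE[_ _ _ _ H] := fP n; exact: H.
Qed.

Lemma ball_dist0_iso X Y : ball_dist X Y = 0 -> vtgraph_isob X Y.
Proof.
move=> d0; apply: balls_iso_iso => n.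
have [|m mXY] := @ball_dist_lt X Y (2 ^- n).
  by rewrite d0 invr_gt0 exprn_gt0.
rewrite ltf_pV2 ?posrE ?exprn_gt0// ltr_eXn2l ?ltr1n// => nm.
exact: balls_iso_le (ltnW nm) mXY.
Qed.

Definition vt_dist (x y : vtspace R) : R := ball_dist (repr x) (repr y).

Lemma vt_distE X Y :
  vt_dist (\pi_(vtspace R) X) (\pi_(vtspace R) Y) = ball_dist X Y.
Proof.
have rX (Z : vtgraph) : vtgraph_isob (repr (\pi_(vtspace R) Z)) Z.
  by have /eqmodP := reprK (\pi_(vtspace R) Z).
by rewrite /vt_dist (ball_dist_iso _ (rX X)) ball_dist_sym
  (ball_dist_iso _ (rX Y)) ball_dist_sym.
Qed.

Lemma vt_distxx x : vt_dist x x = 0.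
Proof.
apply/eqP; rewrite eq_le ball_dist_ge0 andbT leNgt; apply/negP => d0.
have [n] : exists n, (2 : R) ^- n < vt_dist x x.
  have [n nd] := filter_ex (near_infty_natSinv_expn_lt (PosNum d0)).
  by exists n; move: nd; rewrite /= div1r.
by rewrite ltNge ball_dist_le//; apply: balls_iso_of_iso;
  exact: vtgraph_iso_refl.
Qed.

Lemma vt_dist_positivity x y : vt_dist x y = 0 -> x = y.
Proof.
by move=> /ball_dist0_iso xy; rewrite -[x]reprK -[y]reprK; apply/eqmodP.
Qed.

Lemma vt_dist_sym x y : vt_dist x y = vt_dist y x.
Proof. exact: ball_dist_sym. Qed.

Lemma vt_dist_triangle y x z : vt_dist x z <= vt_dist x y + vt_dist y z.
Proof.
apply: (le_trans (ball_dist_ultra (repr y) (repr x) (repr z))).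
by rewrite ge_max lerDl lerDr !ball_dist_ge0.
Qed.

HB.instance Definition _ := isMetric.Build R (vtspace R)
  vt_distxx vt_dist_positivity vt_dist_sym vt_dist_triangle.

End VTMetric.

Section GraphAut.
Variable X : graph.
Implicit Types a b c : graph_aut X.

HB.instance Definition _ := gen_eqMixin (graph_aut X).
HB.instance Definition _ := gen_choiceMixin (graph_aut X).

Lemma graph_autP a b : a =1 b -> a = b.
Proof.
case: a b => [f fi] [g gi] /= /funext fg; rewrite fg in fi *.
by rewrite (Prop_irrelevance fi gi).
Qed.

Definition aut_one : graph_aut X := GraphAut (is_graph_iso_id X).

Definition aut_mul a b : graph_aut X :=
  GraphAut (is_graph_iso_comp (aut_fun_iso b) (aut_fun_iso a)).

Lemma aut_inv_subproof a : exists b, cancel a b /\ cancel b a.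
Proof.
have [[g fK gK] _] := aut_fun_iso a.
by exists (GraphAut (is_graph_iso_inv (aut_fun_iso a) fK gK)).
Qed.

Definition aut_inv a : graph_aut X := projT1 (cid (aut_inv_subproof a)).

Lemma aut_mulA : associative aut_mul.
Proof. by move=> a b c; exact: graph_autP. Qed.

Lemma aut_1mul : left_id aut_one aut_mul.
Proof. by move=> a; exact: graph_autP. Qed.

Lemma aut_mul1 : right_id aut_one aut_mul.
Proof. by move=> a; exact: graph_autP. Qed.

Lemma aut_mulV : left_inverse aut_one aut_inv aut_mul.
Proof.
by move=> a; apply: graph_autP => v; rewrite /aut_inv; case: cid => b [] /= + _.
Qed.

Lemma aut_Vmul : right_inverse aut_one aut_inv aut_mul.
Proof.
by move=> a; apply: graph_autP => v; rewrite /aut_inv; case: cid => b [] /= _.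
Qed.

HB.instance Definition _ := isGroup.Build (graph_aut X)
  aut_mulA aut_1mul aut_mul1 aut_mulV aut_Vmul.

(* Topology of pointwise convergence, the vertex set being discrete. *)
Definition aut_ptws (a : graph_aut X) :
  {ptws X -> discrete_topology {classic X}} := a.

HB.instance Definition _ :=
  Topological.copy (graph_aut X) (initial_topology aut_ptws).

End GraphAut.

HB.mixin Record isTopologicalGroup G of Group G & Topological G := {
  mulg_continuous : continuous (fun xy : G * G => (xy.1 * xy.2)%g);
  invg_continuous : continuous (fun x : G => (x^-1)%g) }.

#[short(type="topologicalGroupType")]
HB.structure Definition TopologicalGroup :=
  {G of isTopologicalGroup G & Group G & Topological G}.

Definition compactly_generated (G : topologicalGroupType) : Prop :=
  exists2 K : set G, compact K &
    forall H : set G, group_closed [in H] -> K `<=` H -> H = [set: G].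

Definition proper_action (G : topologicalGroupType) (X : graph)
    (rho : G -> graph_aut X) : Prop :=
  forall v : X, compact [set g | rho g v = v].

Definition transitive_action (G : topologicalGroupType) (X : graph)
    (rho : G -> graph_aut X) : Prop :=
  forall u v : X, exists g, rho g u = v.

Definition admits_proper_transitive_action (G : topologicalGroupType)
    (X : graph) : Prop :=
  exists rho : {multiplicative G -> graph_aut X},
    [/\ continuous rho, proper_action rho & transitive_action rho].

Definition graphs_of (R : realType) (G : topologicalGroupType) :
    set (vtspace R) :=
  [set \pi_(vtspace R) X | X in [set X : vtgraph |
     admits_proper_transitive_action G X]].

Arguments graphs_of R G : clear implicits.

Definition vertex_boundary (X : graph) (A : set X) : set X :=
  [set v | ~ A v /\ exists2 u, A u & adj u v].

(* Only meaningful when A is finite: fset_set A is empty otherwise. *)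
Definition ncard (T : Type) (A : set T) : nat :=
  #|` fset_set (A : set {classic T})|.

Section Cheeger.
Variable R : realType.
Local Open Scope ereal_scope.

Definition graph_cheeger (X : graph) : \bar R :=
  ereal_inf [set ((ncard (vertex_boundary A))%:R / (ncard A)%:R)%R%:E |
    A in [set A : set X | finite_set A /\ A !=set0]].

Definition cheeger (x : vtspace R) : \bar R := graph_cheeger (repr x).

Lemma ncard_image (T U : Type) (f : T -> U) (A : set T) :
  injective f -> finite_set A -> ncard (f @` A) = ncard A.
Proof.
move=> fi Afin; rewrite /ncard.
rewrite (@fset_set_image {classic T} {classic U} f A)// card_imfset//=.
Qed.

Lemma vertex_boundary_image (X Y : graph) (f : X -> Y) (A : set X) :
  is_graph_iso f -> vertex_boundary (f @` A) = f @` vertex_boundary A.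
Proof.
move=> [[g fK gK] fa]; apply/seteqP; split=> w /=.
- case=> nA [_ [u Au <-] uw]; exists (g w) => //; split.
    by move=> Agw; apply: nA; exists (g w).
  by exists u => //; rewrite -fa gK.
- case=> v [nAv [u Au uv] <-]; split.
    by case=> u' Au' /(can_inj fK) uv'; apply: nAv; rewrite -uv'.
  by exists (f u); [exists u|rewrite fa].
Qed.

Lemma vertex_boundary_finite (X : vtgraph) (A : set X) :
  finite_set A -> finite_set (vertex_boundary A).
Proof.
move=> Afin.
apply: (@sub_finite_set _ _ (\bigcup_(u in A) [set v | adj u v])).
  by move=> v [_ [u Au uv]]; exists u.
by apply: bigcup_finite => // u _; exact: vt_locally_finite.
Qed.

Lemma graph_cheeger_iso (X Y : vtgraph) (f : X -> Y) :
  is_graph_iso f -> graph_cheeger X = graph_cheeger Y.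
Proof.
have le (X' Y' : vtgraph) (h : X' -> Y') : is_graph_iso h ->
    graph_cheeger Y' <= graph_cheeger X'.
  move=> hi; have [hb _] := hi; have hinj := bij_inj hb.
  apply: ereal_inf_le_tmp => _ [A [Afin [v Av]] <-]; exists (h @` A).
    by split; [exact: finite_image|exists (h v); exists v].
  by rewrite vertex_boundary_image// !ncard_image//; exact: vertex_boundary_finite.
move=> fi; apply/eqP; rewrite eq_le (le _ _ _ fi) andbT.
by have [[g fK gK] _] := fi; apply: (le _ _ g); exact: is_graph_iso_inv fi fK gK.
Qed.

Lemma cheegerE (X : vtgraph) : cheeger (\pi_(vtspace R) X) = graph_cheeger X.
Proof.
have /eqmodP/asboolP[f fi] := reprK (\pi_(vtspace R) X).
exact: graph_cheeger_iso fi.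
Qed.

Definition amenable (x : vtspace R) : Prop := cheeger x = 0.

Definition cheeger_of (G : topologicalGroupType) : \bar R :=
  ereal_inf [set cheeger x | x in graphs_of R G].

Definition upper_semicontinuous (T : topologicalType) (f : T -> \bar R) : Prop :=
  forall x a, f x < a%:E -> exists2 V, nbhs x V & forall y, V y -> f y < a%:E.

End Cheeger.

(* Main.v *)
Require Import Defs.
From mathcomp Require Import all_boot all_order all_algebra.
From mathcomp Require Import finmap.
From mathcomp Require Import all_classical all_reals all_analysis.

Set Implicit Arguments.
Unset Strict Implicit.
Unset Printing Implicit Defensive.

Import Order.TTheory GRing.Theory Num.Theory.

Local Open Scope classical_set_scope.
Local Open Scope ereal_scope.

(** Suppose h(X) < a. Since h(X) is an infimum, some finite non-empty set A of
    vertices of X already has |∂A|/|A| < a. This is a local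
    witness: A lies in a ball of some radius n, so A together with its boundary
    lies in the ball of radius n+1 about the same vertex. Any graph Y sharing
    that ball with X contains a copy of A whose boundary is the copy of ∂A
    ([boundary_ball_iso_image]), so h(Y) < a as well ([cheeger_local]). The
    graphs Y sharing the ball of radius n+1 form a neighbourhood of X, whence
    upper semicontinuity.

    The statement about G is then formal: for a function f that is upper
    semicontinuous, the infimum of f on a set S is at most the value of f at
    any point of the closure of S ([usc_inf_le_closure]). At an amenable graph
    this bounds the infimum by 0, and Cheeger constants are non-negative. *)

Lemma finite_sub_graph_ball (X : vtgraph) (o : X) (A : set X) :
  finite_set A -> exists n, A `<=` graph_ball n o.
Proof.
move=> /(@finite_fsetP {classic X})[D ->].
have /choice[r rP] := graph_ball_reach o.
exists (\max_(v <- D) r v)%N => v vD.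
apply: graph_ball_le (rP v).
exact: (@leq_bigmax_seq {classic X} _ xpredT r v).
Qed.

(** An isomorphism between balls is only injective on its ball, hence this
    version of [ncard_image] for a function that is injective on the set. *)
Lemma ncard_image_in (T U : Type) (f : T -> U) (A : set T) :
  (forall u v, A u -> A v -> f u = f v -> u = v) -> finite_set A ->
  ncard (f @` A) = ncard A.
Proof.
move=> finj Afin; rewrite /ncard.
rewrite (@fset_set_image {classic T} {classic U} f A)// card_in_imfset//=.
move=> u v uA vA; move: uA vA.
rewrite !(@in_fset_set {classic T})// !inE; exact: finj.
Qed.

Lemma vertex_boundary_sub_ball (X : graph) n (o : X) (A : set X) :
  A `<=` graph_ball n o -> vertex_boundary A `<=` graph_ball n.+1 o.
Proof.
by move=> An v [_ [u Au uv]]; apply/graph_ballS; right; exists u => //; exact: An.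
Qed.

(** The extra unit of radius is what makes this true: a neighbour in Y of the
    image of A lies in the ball of radius n+1, so it is the image of a vertex
    of X, which must be a neighbour of A. *)
Lemma boundary_ball_iso_image (X Y : graph) n (o : X) (o' : Y) (f : X -> Y)
    (A : set X) :
  is_ball_iso n.+1 o o' f -> A `<=` graph_ball n o ->
  vertex_boundary (f @` A) = f @` vertex_boundary A.
Proof.
move=> fiso An; have /is_ball_isoE[_ fi fs _ fa] := fiso.
have /is_ball_isoE[fn _ _ _ _] := is_ball_iso_le (leqnSn n) fiso.
have AS v : A v -> graph_ball n.+1 o v.
  by move=> /An; exact: graph_ball_le.
apply/seteqP; split=> w.
- case=> nAw [_ [u Au <-] uw].
  have [|v bv fv] := fs w.
    by apply/graph_ballS; right; exists (f u) => //; exact/fn/An.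
  exists v => //; split; first by move=> Av; apply: nAw; exists v.
  by exists u => //; rewrite -(fa _ _ (AS _ Au) bv) fv.
- case=> v bAv <-; have bv := vertex_boundary_sub_ball An bAv.
  have [nAv [u Au uv]] := bAv; split.
    case=> u' Au' fu'; apply: nAv.
    by rewrite -(fi _ _ (AS _ Au') bv fu').
  by exists (f u); [exists u|rewrite fa//; exact: AS].
Qed.

Lemma graph_cheeger_ge0 (R : realType) (X : graph) : 0 <= graph_cheeger R X.
Proof.
by apply: le_ereal_inf_tmp => _ [A _ <-]; rewrite lee_fin divr_ge0.
Qed.

(** The bound is witnessed by one finite set, and the radius that works is one
    more than that of a ball containing this set. *)
Lemma cheeger_local (R : realType) (X : vtgraph) (a : \bar R) :
  graph_cheeger R X < a ->
  exists n, forall Y : vtgraph, balls_iso n X Y -> graph_cheeger R Y < a.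
Proof.
move=> /ereal_inf_lt[_ [A [Afin [ o Ao]] <-]] Aa.
have [n An] := finite_sub_graph_ball o Afin.
exists n.+1 => Y [ o1 [ o1' [g giso]]].
(* Vertex transitivity moves the root of the ball in X to the centre of the
   ball that contains A. *)
have [f fiso] : exists f, is_ball_iso n.+1 o o1' f.
  by apply: balls_iso_any; exists o1, o1', g.
have /is_ball_isoE[_ fi _ _ _] := fiso.
apply: le_lt_trans Aa; apply: ereal_inf_lbound; exists (f @` A).
  by split; [exact: finite_image|exists (f o); exists o].
rewrite (boundary_ball_iso_image fiso An) !ncard_image_in//.
- by move=> u v /An bu /An bv; apply: fi; exact: graph_ball_le (leqnSn n) _.
- move=> u v /(vertex_boundary_sub_ball An) + /(vertex_boundary_sub_ball An).
  exact: fi.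
- exact: vertex_boundary_finite.
Qed.

Lemma nbhs_balls_iso (R : realType) n (x : vtspace R) :
  nbhs x [set y : vtspace R | balls_iso n (repr x) (repr y)].
Proof.
have e0 : (0 < 2 ^- n :> R)%R by rewrite invr_gt0 exprn_gt0.
apply: filterS (nbhsx_ballx x _ e0) => y.
rewrite ballEmdist => /ball_dist_lt[m mxy].
rewrite ltf_pV2 ?posrE ?exprn_gt0// ltr_eXn2l ?ltr1n// => nm.
exact: balls_iso_le (ltnW nm) mxy.
Qed.

Lemma cheeger_usc (R : realType) : upper_semicontinuous (@cheeger R).
Proof.
move=> x a /cheeger_local[n nP].
exists [set y : vtspace R | balls_iso n (repr x) (repr y)].
  exact: nbhs_balls_iso.
by move=> y /nP.
Qed.

Lemma usc_inf_le_closure (R : realType) (T : topologicalType) (f : T -> \bar R)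
    (S : set T) (x : T) :
  upper_semicontinuous f -> closure S x -> ereal_inf (f @` S) <= f x.
Proof.
move=> fusc Sx; rewrite leNgt; apply/negP => fx.
(* Upper semicontinuity speaks of real bounds only, so a real number is placed
   between the two extended reals. *)
have [a fxa aS] : exists2 a : R, f x < a%:E & a%:E <= ereal_inf (f @` S).
  move: fx; case: (ereal_inf _) => [r||].
  - by exists r.
  - case: (f x) => [s|//|] _.
      by exists (s + 1)%R; rewrite ?lte_fin ?ltrDl ?leey.
    by exists 0%R; rewrite ?ltNyr ?leey.
  - by rewrite ltNge leNye.
have [V xV Va] := fusc _ _ fxa.
have [y [Sy /Va]] := Sx V xV.
apply/negP; rewrite -leNgt; apply: le_trans aS _.
by apply: ereal_inf_lbound; exists y.
Qed.

Theorem theorem1p13 (R : realType) :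
  upper_semicontinuous (@cheeger R) /\
  (forall G : topologicalGroupType,
     compactly_generated G ->
     totally_disconnected [set: G] ->
     locally_compact [set: G] ->
     (exists2 x : vtspace R, closure (graphs_of R G) x & amenable x) ->
     cheeger_of R G = 0).
Proof.
split=> [|G _ _ _ [x Gx x0]]; first exact: cheeger_usc.
apply/eqP; rewrite eq_le; apply/andP; split.
  rewrite -[leRHS]x0; exact: (usc_inf_le_closure (@cheeger_usc R) Gx).
by apply: le_ereal_inf_tmp => _ [y _ <-]; exact: graph_cheeger_ge0.
Qed.
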